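(* Let $\alpha\in(0,1)$, let $0\le\delta<1$, and let $W$ be an input-output linkage matrix of $n$ firms (the true matrix, with all of the data). Let $U$ be an observed input-output linkage matrix of the same $n$ firms, obtained from $W$ with missing data such that for each $i=1,\dots,n$ the missing data accounts for at most a $\delta$ share of the total intermediate input use of firm $i$. Then the influence vectors satisfy $$\|v_U-v_W\|_1\le \frac{\delta}{\alpha}\cdot\frac{(1-\alpha)(2-\delta)}{1-\delta}.$$
   Context: An input-output linkage matrix of $n$ firms is a real $n\times n$ matrix $W=(w_{ij})$ with $w_{ij}\ge 0$, $w_{ii}=0$ and $\sum_{j=1}^n w_{ij}=1$ for all $i$; $w_{ij}$ is the share of the intermediate inputs of firm $i$ that come from firm $j$. With $W'$ the transpose of $W$ and $\vec{\mathbf 1}$ the all-ones column vector, the influence vector of $W$ (for the parameter $\alpha\in(0,1)$) is $v_W=\frac{\alpha}{n}(I-(1-\alpha)W')^{-1}\vec{\mathbf 1}$ (the inverse exists). Missing data: firm $i$ has total intermediate input use $\mathrm{II}_i>0$, of which $w_{ij}\mathrm{II}_i$ comes from firm $j$. Only amounts $x_{ij}$ with $0\le x_{ij}\le w_{ij}\mathrm{II}_i$ are observed; the rest is missing. ''The missing data accounts for at most a $\delta$ share of the total intermediate input use of firm $i$'' means $\sum_j x_{ij}\ge(1-\delta)\mathrm{II}_i$. The observed matrix is $U=(u_{ij})$ with $u_{ij}=x_{ij}/\sum_k x_{ik}$. $\|\cdot\|_1$ is the usual $\ell^1$ norm of vectors. *)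

(* Defs.v *)
From mathcomp Require Import all_boot all_order all_algebra.
From mathcomp Require Import reals.

Set Implicit Arguments.
Unset Strict Implicit.
Unset Printing Implicit Defensive.

Import Order.TTheory GRing.Theory Num.Theory.
Local Open Scope ring_scope.

Definition linkage_matrix (R : realType) (n : nat) (W : 'M[R]_n) : Prop :=
  [/\ forall i j, 0 <= W i j,
      forall i, W i i = 0
    & forall i, \sum_j W i j = 1].

(* [invmx] returns its argument on non-invertible matrices; for a linkage
   matrix W and 0 < alpha < 1 the matrix below is invertible. *)
Definition influence_vector (R : realType) (n : nat) (alpha : R)
    (W : 'M[R]_n) : 'cV[R]_n :=
  (alpha / n%:R) *: (invmx (1%:M - (1 - alpha) *: W^T) *m const_mx 1).

(* [x i j] is the observed part of the amount [W i j * II i] of intermediate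
   inputs that firm i buys from firm j; the rest of that amount is missing. *)
Definition observed_amounts (R : realType) (n : nat) (W : 'M[R]_n)
    (II : 'I_n -> R) (x : 'M[R]_n) : Prop :=
  forall i j, 0 <= x i j <= W i j * II i.

Definition missing_share_at_most (R : realType) (n : nat) (delta : R)
    (II : 'I_n -> R) (x : 'M[R]_n) : Prop :=
  forall i, (1 - delta) * II i <= \sum_j x i j.

Definition observed_matrix (R : realType) (n : nat) (x : 'M[R]_n) : 'M[R]_n :=
  \matrix_(i, j) (x i j / \sum_k x i k).

(* The matrix norm of MathComp-Analysis is the sup norm, hence this one. *)
Definition l1norm (R : realType) (n : nat) (v : 'cV[R]_n) : R :=
  \sum_i `|v i 0|.

(* Main.v *)
Require Import Defs.
From mathcomp Require Import all_boot all_order all_algebra.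
From mathcomp Require Import reals.
From mathcomp Require Import ring lra.

Set Implicit Arguments.
Unset Strict Implicit.

Import Order.TTheory GRing.Theory Num.Theory.
Local Open Scope ring_scope.

(** The influence vector is the fixed point of [v = (alpha/n) 1 + (1-alpha) W' v],
    and [W'] does not increase the l1 norm, so [v_W] has norm at most 1.
    Subtracting the equations of [v_U] and [v_W] gives
    [d = (1-alpha) U' d + (1-alpha) (U-W)' v_W] for [d = v_U - v_W], hence
    [alpha |d| <= (1-alpha) max_i sum_j |u_ij - w_ij|]. If firm [i] has the
    observed share [s >= 1 - delta] and observed fractions [y_ij <= w_ij], then
    [|y_ij/s - w_ij| <= (y_ij/s - y_ij) + (w_ij - y_ij)], and both brackets
    sum to [1 - s] over [j]; the resulting bound [2 delta] is at most
    [delta (2 - delta) / (1 - delta)]. *)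

Lemma l1norm_ge0 (R : realType) (n : nat) (v : 'cV[R]_n) : 0 <= l1norm v.
Proof. by apply: sumr_ge0. Qed.

Lemma l1norm_eq0 (R : realType) (n : nat) (v : 'cV[R]_n) :
  l1norm v = 0 -> v = 0.
Proof.
move=> /psumr_eq0P v0; apply/matrixP => i j; rewrite ord1 mxE.
by apply/normr0_eq0/v0.
Qed.

Lemma l1norm_triangle (R : realType) (n : nat) (u v : 'cV[R]_n) :
  l1norm (u + v) <= l1norm u + l1norm v.
Proof.
rewrite /l1norm -big_split; apply: ler_sum => i _.
by rewrite mxE ler_normD.
Qed.

Lemma l1normZ (R : realType) (n : nat) (a : R) (v : 'cV[R]_n) :
  l1norm (a *: v) = `|a| * l1norm v.
Proof.
by rewrite /l1norm mulr_sumr; apply: eq_bigr => i _; rewrite mxE normrM.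
Qed.

(** The rows of [A] are the columns of [A^T], and the operator norm for l1 is the largest column
    sum; exchanging the two sums shows this. *)
Lemma l1norm_trmx_mul (R : realType) (n : nat) (c : R) (A : 'M[R]_n)
    (v : 'cV[R]_n) :
  (forall i, \sum_j `|A i j| <= c) -> l1norm (A^T *m v) <= c * l1norm v.
Proof.
move=> Ac; rewrite /l1norm mulr_sumr.
apply: (@le_trans _ _ (\sum_i \sum_j `|A j i| * `|v j 0|)).
  apply: ler_sum => i _; rewrite mxE; apply: (le_trans (ler_norm_sum _ _ _)).
  by apply: ler_sum => j _; rewrite normrM mxE.
rewrite exchange_big; apply: ler_sum => j _.
by rewrite -mulr_suml ler_wpM2r.
Qed.

Section Influence.

Variables (R : realType) (n : nat) (alpha : R).
Hypothesis halpha : 0 < alpha < 1.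

Lemma linkage_l1norm_le (W : 'M[R]_n) (v : 'cV[R]_n) :
  linkage_matrix W -> l1norm (W^T *m v) <= l1norm v.
Proof.
case=> W0 _ W1; rewrite -[leRHS]mul1r; apply: l1norm_trmx_mul => i.
by rewrite -[leRHS](W1 i); apply: ler_sum => j _; rewrite ger0_norm.
Qed.

(** Serves three times: [e = 0] gives invertibility, a constant [e] the norm of the influence
    vector, and a perturbation term [e] the Lipschitz bound. *)
Lemma linkage_contraction (W : 'M[R]_n) (d e : 'cV[R]_n) :
  linkage_matrix W -> d = (1 - alpha) *: (W^T *m d) + e ->
  alpha * l1norm d <= l1norm e.
Proof.
move=> hW dE.
have /andP[a0 a1] := halpha.
have a'0 : 0 <= 1 - alpha by lra.
have := l1norm_triangle ((1 - alpha) *: (W^T *m d)) e.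
rewrite -dE l1normZ ger0_norm // => h.
have := ler_wpM2l a'0 (linkage_l1norm_le d hW).
lra.
Qed.

Lemma linkage_unitmx (W : 'M[R]_n) :
  linkage_matrix W -> 1%:M - (1 - alpha) *: W^T \in unitmx.
Proof.
(* [det0P] yields a row vector killed from the left, so the determinant is transposed first; then
   [v^T] is a column in the kernel of the original matrix. *)
move=> hW; rewrite unitmxE unitfE -det_tr; apply/negP => /det0P[v v0 vM].
move/eqP: v0; apply; apply: trmx_inj; rewrite trmx0; apply: l1norm_eq0.
have vE : v^T = (1 - alpha) *: (W^T *m v^T) + 0.
  move/(congr1 trmx): vM.
  rewrite trmx_mul trmxK mulmxBl mul1mx -scalemxAl trmx0 addr0.
  by move/eqP; rewrite subr_eq0 => /eqP.
have := linkage_contraction hW vE.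
have -> : l1norm (0 : 'cV[R]_n) = 0 by apply: big1 => i _; rewrite mxE normr0.
have /andP[a0 _] := halpha.
rewrite pmulr_rle0 // => v0.
by apply/eqP; rewrite eq_le v0 l1norm_ge0.
Qed.

Lemma influence_vector_fixpoint (W : 'M[R]_n) :
  linkage_matrix W ->
  influence_vector alpha W =
    (1 - alpha) *: (W^T *m influence_vector alpha W)
      + (alpha / n%:R) *: const_mx 1.
Proof.
move=> hW; set v := influence_vector alpha W.
have : (1%:M - (1 - alpha) *: W^T) *m v = (alpha / n%:R) *: const_mx 1.
  by rewrite /v /influence_vector -scalemxAr mulKVmx // linkage_unitmx.
by rewrite mulmxBl mul1mx -scalemxAl => <-; rewrite addrC subrK.
Qed.

(** The constant term of the fixed-point equation has norm [alpha], which cancels the factor from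
    [linkage_contraction]. *)
Lemma influence_vector_l1norm_le1 (W : 'M[R]_n) :
  linkage_matrix W -> l1norm (influence_vector alpha W) <= 1.
Proof.
move=> hW; have /andP[a0 _] := halpha.
rewrite -(ler_pM2l a0) mulr1.
apply: le_trans (linkage_contraction hW (influence_vector_fixpoint hW)) _.
rewrite l1normZ ger0_norm ?divr_ge0 ?ler0n ?(ltW a0) //.
have -> : l1norm (const_mx 1 : 'cV[R]_n) = n%:R.
  rewrite /l1norm; under eq_bigr do rewrite mxE normr1.
  by rewrite sumr_const card_ord.
(* For [n = 0] the product collapses to 0, which is at most [alpha]. *)
have [->|n0] := eqVneq (n%:R : R) 0; first by rewrite mulr0; lra.
by rewrite divfK.
Qed.

Lemma influence_vector_lipschitz (c : R) (W U : 'M[R]_n) :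
  0 <= c -> linkage_matrix W -> linkage_matrix U ->
  (forall i, \sum_j `|U i j - W i j| <= c) ->
  l1norm (influence_vector alpha U - influence_vector alpha W)
    <= (1 - alpha) * c / alpha.
Proof.
move=> c0 hW hU hc; have /andP[a0 a1] := halpha.
set vU := influence_vector alpha U; set vW := influence_vector alpha W.
have dE : vU - vW = (1 - alpha) *: (U^T *m (vU - vW))
                    + (1 - alpha) *: ((U - W)^T *m vW).
  rewrite {1}/vU {1}/vW influence_vector_fixpoint // (influence_vector_fixpoint hW).
  rewrite -/vU -/vW opprD addrACA subrr addr0 -scalerBr -scalerDr.
  by rewrite mulmxBr [(U - W)^T]linearB /= mulmxBl addrA subrK.
rewrite ler_pdivlMr // mulrC.
apply: le_trans (linkage_contraction hU dE) _.
rewrite l1normZ ger0_norm; last by lra.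
apply: ler_wpM2l; first by lra.
rewrite -[leRHS]mulr1; apply: (@le_trans _ _ (c * l1norm vW)).
  by apply: l1norm_trmx_mul => i; under eq_bigr do rewrite !mxE.
by apply: ler_wpM2l => //; apply: influence_vector_l1norm_le1.
Qed.

End Influence.

Lemma observed_matrix_row_dist (R : realType) (n : nat) (delta : R)
    (W : 'M[R]_n) (II : 'I_n -> R) (x : 'M[R]_n) (i : 'I_n) :
  0 <= delta < 1 -> linkage_matrix W -> (forall i, 0 < II i) ->
  observed_amounts W II x -> missing_share_at_most delta II x ->
  \sum_j `|observed_matrix x i j - W i j| <= 2 * delta.
Proof.
move=> /andP[d0 d1] [_ _ W1] hII hx hmiss.
have I0 := hII i; have hm := hmiss i; set X := \sum_j x i j in hm *.
have X0 : 0 < X by apply: lt_le_trans hm; rewrite mulr_gt0 // subr_gt0.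
have XI : X <= II i.
  rewrite -[leRHS]mul1r -(W1 i) mulr_suml; apply: ler_sum => j _.
  by have /andP[] := hx i j.
(* Here [x i j / II i] is the fraction y_ij and [X / II i] the share s, so that [x i j / X] is
   y_ij/s. *)
apply: (@le_trans _ _ (\sum_j ((x i j / X - x i j / II i)
                               + (W i j - x i j / II i)))).
  apply: ler_sum => j _; rewrite mxE -/X.
  have /andP[x0 xW] := hx i j.
  have h1 : x i j / II i <= x i j / X.
    by apply: ler_wpM2l => //; rewrite lef_pV2.
  have h2 : x i j / II i <= W i j by rewrite ler_pdivrMr.
  by rewrite ler_norml; apply/andP; split; lra.
rewrite big_split /= !sumrB W1 -!mulr_suml -/X divff ?gt_eqF //.
have : 1 - delta <= X / II i by rewrite ler_pdivlMr.
lra.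
Qed.

Theorem theorem3p1 (R : realType) (n : nat) (alpha delta : R)
    (W U : 'M[R]_n) (II : 'I_n -> R) (x : 'M[R]_n)
    (halpha : 0 < alpha < 1) (hdelta : 0 <= delta < 1)
    (hW : linkage_matrix W) (hU : linkage_matrix U)
    (hII : forall i, 0 < II i)
    (hx : observed_amounts W II x)
    (hmiss : missing_share_at_most delta II x)
    (hUx : U = observed_matrix x) :
  l1norm (influence_vector alpha U - influence_vector alpha W)
    <= delta / alpha * ((1 - alpha) * (2 - delta) / (1 - delta)).
Proof.
have /andP[a0 a1] := halpha; have /andP[d0 d1] := hdelta.
have hc i : \sum_j `|U i j - W i j| <= 2 * delta.
  by rewrite hUx; apply: observed_matrix_row_dist hW hII hx hmiss.
have c0 : 0 <= 2 * delta by lra.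
apply: le_trans (influence_vector_lipschitz halpha c0 hW hU hc) _.
have -> : (1 - alpha) * (2 * delta) / alpha = delta / alpha * ((1 - alpha) * 2).
  by ring.
apply: ler_wpM2l; first by rewrite divr_ge0 // ltW.
rewrite -mulrA; apply: ler_wpM2l; first by lra.
(* After clearing the denominator, 2(1 - delta) <= 2 - delta remains, which is [0 <= delta]. *)
by rewrite ler_pdivlMr; lra.
Qed.
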